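(* Let $(X,d)$ be a metric space and let $\mathcal{R}\subset\widetilde{\mathcal{R}}\subset C(\mathbb{R}^+,X)$ be sets of functions each satisfying (K1)-(K4), with associated multivalued semiflows $G\subset\widetilde{G}$. Assume that $K$ is a closed isolated weakly invariant set for $G$ and that $N$ is a closed $G$-admissible isolating neighborhood of $K$ (with respect to $\mathcal{R}$). Let also $\widetilde{K}$ be a closed isolated weakly invariant set for $\widetilde{G}$ such that $K\subset\widetilde{K}$ and such that $N$ is also a $\widetilde{G}$-admissible isolating neighborhood of $\widetilde{K}$ (with respect to $\widetilde{\mathcal{R}}$). Moreover, suppose that $\widetilde{\mathcal{R}}$ satisfies (K5) for $\widetilde{K}$. Then there is an isolating block $B$ of $K$ (with respect to $\mathcal{R}$).
   Context: $\mathbb{R}^+=[0,\infty)$. Conditions on a set $\mathcal{R}\subset C(\mathbb{R}^+,X)$: (K1) For any $x\in X$ there is $\phi\in\mathcal{R}$ with $\phi(0)=x$. (K2) If $\phi\in\mathcal{R}$, then $\phi(\tau+\cdot)\in\mathcal{R}$ for all $\tau\ge 0$. (K3) If $\phi_1,\phi_2\in\mathcal{R}$ and $\phi_1(s)=\phi_2(0)$ for some $s\ge0$, then the function equal to $\phi_1(t)$ on $[0,s]$ and to $\phi_2(t-s)$ on $(s,\infty)$ belongs to $\mathcal{R}$. (K4) If $\{\phi_n\}\subset\mathcal{R}$ and $\phi_n(0)\to x\in X$, then there is $\phi\in\mathcal{R}$ with $\phi(0)=x$ such that, up to a subsequence, $\phi_n\to\phi$ uniformly on compact subsets of $\mathbb{R}^+$.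 (K5) (for a closed isolated weakly invariant set $K$) There is an open neighborhood $\mathcal{O}(K)$ of $K$ such that for any $x\in\mathcal{O}(K)$, any $\phi\in\mathcal{R}$ with $\phi(0)=x$ and any sequence $x_n\to x$ there are a subsequence $x_{n_k}$ and $\phi_{n_k}\in\mathcal{R}$ with $\phi_{n_k}(0)=x_{n_k}$ such that $\phi_{n_k}\to\phi$ uniformly on compact subsets of $[0,t_\phi)$, where $t_\phi=\sup\{t:\phi([0,t])\subset\mathcal{O}(K)\}$. The multivalued semiflow associated with $\mathcal{R}$ is $G(t,x)=\{\phi(t):\phi\in\mathcal{R},\ \phi(0)=x\}$. All the notions below are relative to the chosen set of functions ($\mathcal{R}$ for $G$, $\widetilde{\mathcal{R}}$ for $\widetilde{G}$). A complete trajectory of $\mathcal{R}$ is a function $\phi:\mathbb{R}\to X$ with $\phi(\tau+\cdot)|_{[0,\infty)}\in\mathcal{R}$ for all $\tau\in\mathbb{R}$. A set $A\subset X$ is weakly invariant if for each $x\in A$ there is a complete trajectory $\phi$ of $\mathcal{R}$ with $\phi(0)=x$ and $\phi(\mathbb{R})\subset A$. A closed set $A$ is an isolated weakly invariant set if it is weakly invariant and there is an open neighborhood $U$ of $A$ such that $A$ is the maximal weakly invariant set in $U$. A closed set $N$ is an isolating neighborhood of $A$ if $A\subset \operatorname{int}N$ and $A$ is the maximal weakly invariant set in $N$. A closed set $N$ is $G$-admissible if for all sequences $t_n\to+\infty$ and $\phi_n\in\mathcal{R}$ with $\phi_n([0,t_n])\subset N$ for all $n$, the sequence $\{\phi_n(t_n)\}$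 has a convergent subsequence. Let $B\subset X$ be closed and $x\in\partial B$. Consider all functions $\sigma:[-\delta_1,+\infty)\to X$, $\delta_1\ge 0$, with $\sigma(-\delta_1+\cdot)\in\mathcal{R}$ and $\sigma(0)=x$. The point $x$ is - an egress point if for every such $\sigma$: there is $\varepsilon_2>0$ with $\sigma(t)\notin B$ for $t\in(0,\varepsilon_2]$; and, if $\delta_1>0$, there is $\varepsilon_1\in(0,\delta_1)$ with $\sigma(t)\in B$ for $t\in[-\varepsilon_1,0)$; - an ingress point if for every such $\sigma$: there is $\varepsilon_2>0$ with $\sigma(t)\in\operatorname{int}B$ for $t\in(0,\varepsilon_2]$; and, if $\delta_1>0$, there is $\varepsilon_1\in(0,\delta_1)$ with $\sigma(t)\notin B$ for $t\in[-\varepsilon_1,0)$; - a bounce-off point if for every such $\sigma$: there is $\varepsilon_2>0$ with $\sigma(t)\notin B$ for $t\in(0,\varepsilon_2]$; and, if $\delta_1>0$, there is $\varepsilon_1\in(0,\delta_1)$ with $\sigma(t)\notin B$ for $t\in[-\varepsilon_1,0)$. The sets of egress, ingress and bounce-off points are $B^e,B^i,B^b$, and $B^-=B^e\cup B^b$. An isolating block of $K$ is a closed set $B\subset X$ which is an isolating neighborhood of $K$, with $\partial B=B^-\cup B^i$ and $B^-$ closed. *)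

(* Defs.v *)
From HB Require Import structures.
From mathcomp Require Import all_boot all_order all_algebra.
From mathcomp Require Import all_classical all_reals all_analysis.

Set Implicit Arguments.
Unset Strict Implicit.
Unset Printing Implicit Defensive.
Import Order.TTheory GRing.Theory Num.Theory numFieldNormedType.Exports.
Local Open Scope classical_set_scope.
Local Open Scope ring_scope.

(* The time half-line [0, +oo[ as a type, with the topology induced by R. *)
Definition halfline (R : realType) : Type := [set t : R | 0 <= t].

HB.instance Definition _ (R : realType) :=
  Topological.on (halfline R).

Definition time (R : realType) (t : halfline R) : R := set_val t.

Lemma at_time_subproof (R : realType) (r : R) :
  Num.max 0 r \in [set t : R | 0 <= t].
Proof. by apply/mem_set; rewrite /= le_max lexx. Qed.

(* The point of [0, +oo[ with value r; negative r is truncated to 0, but below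
   it is only applied to nonnegative reals. *)
Definition at_time (R : realType) (r : R) : halfline R :=
  exist _ (Num.max 0 r) (at_time_subproof r).

Section families_of_trajectories.
Context {R : realType} {X : metricType R}.
Implicit Types (F : set (halfline R -> X)) (phi psi : halfline R -> X).
Implicit Types (A B K N O U : set X).

Definition cont_halfline : set (halfline R -> X) :=
  [set phi | continuous phi].

Definition start phi : X := phi (at_time 0).

Definition translate (tau : halfline R) phi : halfline R -> X :=
  fun t => phi (at_time (time tau + time t)).

Definition concat phi psi (s : halfline R) : halfline R -> X :=
  fun t => if time t <= time s then phi t else psi (at_time (time t - time s)).

(* phi([0, t]) is contained in A *)
Definition stays_in phi (t : halfline R) A : Prop :=
  forall s, time s <= time t -> A (phi s).

Definition K1 F : Prop := forall x : X, exists2 phi, F phi & start phi = x.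

Definition K2 F : Prop := forall phi tau, F phi -> F (translate tau phi).

Definition K3 F : Prop := forall phi psi s,
  F phi -> F psi -> phi s = start psi -> F (concat phi psi s).

Definition K4 F : Prop :=
  forall (phi_ : nat -> halfline R -> X) (x : X),
    (forall n, F (phi_ n)) -> start (phi_ n) @[n --> \oo] --> x ->
    exists phi, [/\ F phi, start phi = x &
      exists2 k : nat -> nat, increasing_seq k &
        {family compact, phi_ (k n) @[n --> \oo] --> phi}].

Definition exit_time O phi : \bar R :=
  ereal_sup [set (time t)%:E | t in [set t | stays_in phi t O]].

Definition K5 F K : Prop :=
  exists O : set X, [/\ open O, K `<=` O &
    forall (x : X) phi (x_ : nat -> X),
      O x -> F phi -> start phi = x -> x_ n @[n --> \oo] --> x ->
      exists2 k : nat -> nat, increasing_seq k &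
        exists phi_ : nat -> halfline R -> X,
          (forall n, F (phi_ n) /\ start (phi_ n) = x_ (k n)) /\
          {family [set C | compact C /\
                     forall t, C t -> ((time t)%:E < exit_time O phi)%E],
            phi_ n @[n --> \oo] --> phi}].

Definition complete_trajectory F (gamma : R -> X) : Prop :=
  forall tau : R, F (fun t => gamma (tau + time t)).

Definition weakly_invariant F A : Prop :=
  forall x, A x -> exists gamma : R -> X,
    [/\ complete_trajectory F gamma, gamma 0 = x & forall t, A (gamma t)].

Definition maximal_weakly_invariant_in F A U : Prop :=
  [/\ weakly_invariant F A, A `<=` U &
    forall A', weakly_invariant F A' -> A' `<=` U -> A' `<=` A].

Definition isolated_weakly_invariant F A : Prop :=
  [/\ closed A, weakly_invariant F A &
    exists U : set X, [/\ open U, A `<=` U & maximal_weakly_invariant_in F A U]].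

Definition isolating_neighborhood F A N : Prop :=
  [/\ closed N, A `<=` N° & maximal_weakly_invariant_in F A N].

Definition admissible F N : Prop :=
  closed N /\
  forall (t_ : nat -> halfline R) (phi_ : nat -> halfline R -> X),
    time (t_ n) @[n --> \oo] --> +oo ->
    (forall n, F (phi_ n)) ->
    (forall n, stays_in (phi_ n) (t_ n) N) ->
    exists2 k : nat -> nat, increasing_seq k &
      exists x : X, phi_ (k n) (t_ (k n)) @[n --> \oo] --> x.

Definition boundary B : set X := closure B `\` B°.

(* sigma : [-delta, +oo[ -> X is encoded by a function on R whose values
   before -delta are irrelevant. *)
Definition trajectory_through F (x : X) (delta : R) (sigma : R -> X) : Prop :=
  [/\ 0 <= delta, F (fun t => sigma (- delta + time t)) & sigma 0 = x].

(* Right after time 0, sigma lies in A. *)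
Definition right_after (sigma : R -> X) A : Prop :=
  exists2 e : R, 0 < e & forall t, 0 < t <= e -> A (sigma t).

(* Right before time 0, sigma lies in A; void if sigma starts at time 0. *)
Definition right_before (delta : R) (sigma : R -> X) A : Prop :=
  0 < delta ->
  exists2 e : R, 0 < e < delta & forall t, - e <= t < 0 -> A (sigma t).

Definition egress F B : set X :=
  [set x | boundary B x /\ forall delta sigma,
    trajectory_through F x delta sigma ->
    right_after sigma (~` B) /\ right_before delta sigma B].

Definition ingress F B : set X :=
  [set x | boundary B x /\ forall delta sigma,
    trajectory_through F x delta sigma ->
    right_after sigma B° /\ right_before delta sigma (~` B)].

Definition bounce_off F B : set X :=
  [set x | boundary B x /\ forall delta sigma,
    trajectory_through F x delta sigma ->
    right_after sigma (~` B) /\ right_before delta sigma (~` B)].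

Definition exit_set F B : set X := egress F B `|` bounce_off F B.

Definition isolating_block F K B : Prop :=
  [/\ closed B, isolating_neighborhood F K B,
      boundary B = exit_set F B `|` ingress F B & closed (exit_set F B)].

End families_of_trajectories.

(* Main.v *)
Require Import Defs.
From mathcomp Require Import all_boot all_order all_algebra.
From mathcomp Require Import all_classical all_reals all_analysis.
From mathcomp Require Import ring lra.
Import Order.TTheory GRing.Theory Num.Theory numFieldNormedType.Exports.
Local Open Scope classical_set_scope.
Local Open Scope ring_scope.
Set Implicit Arguments.
Unset Strict Implicit.
Unset Printing Implicit Defensive.

(* Since F is contained in Ft, the egress, ingress and bounce-off conditions
   for Ft imply those for F; by (K1) exit and ingress points are disjoint, so an
   isolating block of Kt for Ft inside N is also one of K for F.  It remains to
   build a block for Ft and Kt.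

   Let Q be a continuous cut-off, equal to 1 on a neighborhood V of Kt and
   positive only inside N and the set where (K5) applies; let A be the set of
   limits of phi_n(t_n), where phi_n([0, t_n]) is contained in N and
   t_n -> +oo.  Over all trajectories phi from x and all t >= 0 put
     p(x) = sup (1 + t) min_[0,t] Q(phi),
     q(x) = sup (2 - 1/(1 + t)) dist(phi(t), A) min_[0,t] Q(phi).
   Prolonging trajectories to the left (K3) shows that p and q strictly
   decrease along every trajectory in V where they are finite and positive.
   The cut-off replaces the discontinuous exit times: (K5) makes the superlevel
   sets open, (K4) and admissibility make them closed where needed.  A point in
   A with a forward trajectory in N lies in Kt, so for M large and eps small
     B = {x in V : p(x) >= M and q(x) <= eps}
   stays away from the boundary of V.  Trajectories leave B through p = M and
   enter it through q = eps: a point with p = M is egress if q < eps and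
   bounce-off if q = eps, and the remaining boundary points are ingress. *)

(** * Sequences and the time half-line *)

Section sequences.
Context {R : realType}.

Lemma cvg_ge_id (k : nat -> nat) : (forall n, (n <= k n)%N) -> k @ \oo --> \oo.
Proof.
move=> hk; apply/cvgnyPge => A; exists A => // n /= An.
exact: leq_trans An (hk n).
Qed.

Lemma increasing_seq_ge_id (k : nat -> nat) :
  increasing_seq k -> forall n, (n <= k n)%N.
Proof.
move=> /increasing_seqP kS; elim=> // n IH.
by apply: leq_ltn_trans IH _; have := kS n; rewrite ltEnat.
Qed.

Lemma cvg_ball_invn (X : pseudoMetricType R) (u : nat -> X) (x : X) :
  (forall n, ball x n.+1%:R^-1 (u n)) -> u @ \oo --> x.
Proof.
move=> hu; apply/cvg_ballP => e e0; near=> n.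
apply: le_ball (hu n).
have : n.+1%:R^-1 < e by near: n; exact: near_infty_natSinv_lt (PosNum e0).
exact: ltW.
Unshelve. all: by end_near. Qed.

Lemma bounded_cvg_subseq (t_ : nat -> R) C : (forall n, 0 <= t_ n <= C) ->
  exists k : nat -> nat, exists2 t, 0 <= t <= C &
    (forall n, (n <= k n)%N) /\ t_ (k n) @[n --> \oo] --> t.
Proof.
move=> ht; have bt : bounded_fun t_.
  exists C; split; first exact: num_real.
  move=> x Cx n _ /=; have /andP[t0 tC] := ht n.
  by rewrite ger0_norm// (le_trans tC)// ltW.
have [k ik kt] := bolzano_weierstrass bt.
exists k, (lim (t_ \o k @ \oo)); last by split; [exact: increasing_seq_ge_id|].
apply/andP; split.
- by apply: limr_ge => //; near=> n; have /andP[] := ht (k n).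
- by apply: limr_le => //; near=> n; have /andP[] := ht (k n).
Unshelve. all: by end_near. Qed.

Lemma closure_seq (X : pseudoMetricType R) (A : set X) x : closure A x ->
  exists2 u : nat -> X, (forall n, A (u n)) & u @ \oo --> x.
Proof.
move=> Ax.
have /choice[u hu] : forall n, exists y, A y /\ ball x n.+1%:R^-1 y.
  move=> n; have [y [Ay xy]] := Ax _ (nbhsx_ballx x n.+1%:R^-1 ltac:(by [])).
  by exists y.
exists u; first by move=> n; have [] := hu n.
by apply: cvg_ball_invn => n; have [] := hu n.
Qed.

Lemma not_nbhs_seq (X : pseudoMetricType R) (A : set X) (x : X) : ~ nbhs x A ->
  exists2 u : nat -> X, (forall n, ~ A (u n)) & u @ \oo --> x.
Proof.
move=> nA; apply: (@closure_seq X (~` A)) => B xB.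
apply: contrapT => nAB; apply: nA.
apply: filterS xB => y By; apply: contrapT => nAy; apply: nAB.
by exists y.
Qed.

End sequences.

Section half_line.
Context {R : realType}.

Lemma time_ge0 (t : halfline R) : 0 <= time t.
Proof. by case: t => t t0; exact: (set_mem t0). Qed.

Lemma at_timeK (r : R) : 0 <= r -> time (at_time r) = r.
Proof. exact: max_r. Qed.

Lemma timeK (t : halfline R) : at_time (time t) = t.
Proof. apply: val_inj; exact: (max_r (time_ge0 t)). Qed.

Lemma at_time_continuous : continuous (@at_time R).
Proof.
apply: continuous_comp_initial.
rewrite (_ : _ \o _ = Num.max 0) //.
move=> x; apply: (@continuous_max R R (cst 0) id x).
- exact: cvg_cst.
- exact: cvg_id.
Qed.

Lemma compact_time_le (C : R) : compact [set t : halfline R | time t <= C].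
Proof.
have -> : [set t : halfline R | time t <= C] = @at_time R @` `[0, C]%classic.
  apply/seteqP; split => [t /= tC|_ /= [r + <-]].
    exists (time t); last exact: timeK.
    by rewrite in_itv/= time_ge0.
  by rewrite in_itv/= => /andP[r0 rC]; rewrite at_timeK.
apply: continuous_compact; last exact: segment_compact.
apply: continuous_subspaceT; exact: at_time_continuous.
Qed.

End half_line.

(* Trajectories are handled as functions on the whole line; their values at
   negative times are irrelevant. *)
Definition real_paths {R : realType} {X : metricType R}
  (F : set (halfline R -> X)) : set (R -> X) :=
  [set f : R -> X | F (f \o @time R)].

Definition stays {R : realType} {X : Type} (f : R -> X) (t : R) (A : set X) :=
  forall s, 0 <= s <= t -> A (f s).

(** Lower semicontinuity in the starting point. This is the form in which (K5) is used: the exit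
    time gives way to a closed interval [[0, C]] on which [f] stays in [W]. *)
Definition paths_lsc {R : realType} {X : metricType R}
    (F : set (halfline R -> X)) (W : set X) : Prop :=
  forall f (u : nat -> X) C, 0 <= C -> real_paths F f -> stays f C W ->
    u @ \oo --> f 0 ->
    exists2 k : nat -> nat, (forall n, (n <= k n)%N) &
      exists2 g_ : nat -> R -> X,
        (forall n, real_paths F (g_ n) /\ g_ n 0 = u (k n)) &
        forall e : R, 0 < e -> \forall n \near \oo,
          forall s : R, 0 <= s <= C -> ball (f s) e (g_ n s).

Section real_paths.
Context {R : realType} {X : metricType R}.
Variable F : set (halfline R -> X).
Implicit Types (f g : R -> X) (x y : X).

Lemma real_paths_at_time phi : F phi -> real_paths F (phi \o @at_time R).
Proof.
move=> Fphi; rewrite /real_paths/=.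
by rewrite (_ : _ \o _ = phi)//; apply/funext => t /=; rewrite timeK.
Qed.

(** Composing with [Num.max 0] freezes [f] before time 0, which turns continuity on the half-line
    into continuity on the whole line. *)
Lemma real_paths_continuous f : F `<=` cont_halfline -> real_paths F f ->
  continuous (f \o Num.max 0).
Proof.
move=> Fc /Fc cf x.
exact: (continuous_comp (@at_time_continuous R x) (cf (at_time x))).
Qed.

Lemma real_paths_translate f s : K2 F -> 0 <= s -> real_paths F f ->
  real_paths F (fun r => f (s + r)).
Proof.
move=> F2 s0 Ff; rewrite /real_paths/=.
have := F2 _ (at_time s) Ff; rewrite /translate/=.
congr F; apply/funext => t /=.
by rewrite !at_timeK// addr_ge0// time_ge0.
Qed.

Lemma real_paths_concat f g s : K3 F -> 0 <= s -> real_paths F f ->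
  real_paths F g -> f s = g 0 ->
  real_paths F (fun r => if r <= s then f r else g (r - s)).
Proof.
move=> F3 s0 Ff Fg fg; rewrite /real_paths/=.
have := F3 _ _ (at_time s) Ff Fg; rewrite /= /start/= !at_timeK//.
move=> /(_ fg); rewrite /concat; congr F; apply/funext => t /=.
rewrite at_timeK//; case: ifPn => //; rewrite -ltNge => st.
by rewrite at_timeK// subr_ge0 ltW.
Qed.

Lemma family_cvg_ball (T : choiceType) (fam : set (set T))
    (phi_ : nat -> T -> X) (phi : T -> X) (A : set T) :
  {family fam, phi_ @ \oo --> phi} -> fam A -> forall e, 0 < e ->
  \forall n \near \oo, forall t, A t -> ball (phi t) e (phi_ n t).
Proof.
move=> + famA e e0 => /fam_cvgP h.
apply: (h A famA [set psi | forall t, A t -> ball (phi t) e (psi t)]).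
apply/uniform_nbhs; exists [set xy | ball xy.1 e xy.2]; split => //.
exact: (entourage_ball _ (PosNum e0)).
Qed.

Lemma real_paths_compactness (g_ : nat -> R -> X) x : K4 F ->
  (forall n, real_paths F (g_ n)) -> g_ n 0 @[n --> \oo] --> x ->
  exists f, [/\ real_paths F f, f 0 = x &
    exists2 k : nat -> nat, (forall n, (n <= k n)%N) &
      forall C e : R, 0 < e -> \forall n \near \oo,
        forall s : R, 0 <= s <= C -> ball (f s) e (g_ (k n) s)].
Proof.
move=> F4 Fg gx.
have [||phi [Fphi phix [k ik kphi]]] := F4 (fun n => g_ n \o @time R) x.
- exact: Fg.
- suff : (fun n => start (g_ n \o @time R)) = (fun n => g_ n 0) by move=> ->.
  by apply/funext => n; rewrite /start/= at_timeK.
exists (phi \o @at_time R); split => //; first exact: real_paths_at_time.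
exists k; first exact: increasing_seq_ge_id.
move=> C e e0.
have := family_cvg_ball kphi (@compact_time_le R C) e0.
apply: filterS => n h s /andP[s0 sC] /=.
have := h (at_time s); rewrite /= at_timeK//; exact.
Qed.

Lemma real_paths_lsc K : F `<=` cont_halfline -> K5 F K ->
  exists W : set X, [/\ open W, K `<=` W & paths_lsc F W].
Proof.
move=> Fc [W [oW KW h]]; exists W; split => // f u C C0 Ff fW uf.
have Wf0 : W (f 0) by apply: fW; rewrite lexx.
have f0 : start (f \o @time R) = f 0 by rewrite /start/= at_timeK.
have [k ik [phi_ [phiP phif]]] := h (f 0) (f \o @time R) u Wf0 Ff f0 uf.
exists k; first exact: increasing_seq_ge_id.
exists (fun n => phi_ n \o @at_time R).
  move=> n; have [Fphi phiu] := phiP n; split => //.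
  exact: real_paths_at_time.
(* (K5) covers only compact sets strictly before the exit time; as [W] is open, [f] stays in it
   slightly beyond [C], so [[0, C]] qualifies. *)
have [C' CC' fW'] : exists2 C', C < C' & stays f C' W.
  have /= := real_paths_continuous Fc Ff (x := C) .
  move=> /(_ W); rewrite /= max_r//.
  have : W (f C) by apply: fW; rewrite C0 lexx.
  move=> WfC /(_ (open_nbhs_nbhs (conj oW WfC))).
  move=> /nbhs_ballP[d /= d0 dW]; exists (C + d / 2).
    by rewrite ltrDl divr_gt0.
  move=> s /andP[s0 sd]; have [sC|Cs] := leP s C.
    by apply: fW; rewrite s0.
  have := dW s; rewrite /= max_r//; apply.
  rewrite /ball/= ltr0_norm ?subr_lt0//; lra.
move=> e e0.
apply: filterS (family_cvg_ball (A := [set t | time t <= C]) phif _ e0).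
  move=> n hn s /andP[s0 sC] /=.
  have := hn (at_time s); rewrite /= at_timeK//; exact.
split; first exact: compact_time_le.
move=> t /= tC; apply: lt_le_trans (_ : (C'%:E <= _)%E).
    by rewrite lte_fin (le_lt_trans tC).
  have C'0 : 0 <= C' by rewrite (le_trans C0)// ltW.
  apply: ereal_sup_ubound; exists (at_time C'); last by rewrite at_timeK.
  move=> s; rewrite /= at_timeK// => sC'; apply: fW'.
  by rewrite time_ge0.
Qed.

Lemma real_paths_admissible N (g_ : nat -> R -> X) (t_ : nat -> R) :
  admissible F N -> (forall n, real_paths F (g_ n)) ->
  (forall n, n%:R <= t_ n) ->
  (forall n, stays (g_ n) (t_ n) N) ->
  exists2 k : nat -> nat, (forall n, (n <= k n)%N) &
    exists y, g_ (k n) (t_ (k n)) @[n --> \oo] --> y.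
Proof.
move=> [_ h] Fg nt gN.
have t0 n : 0 <= t_ n by rewrite (le_trans _ (nt n)).
have [|||k ik [y ky]] := h (fun n => at_time (t_ n)) (fun n => g_ n \o @time R).
- suff -> : (fun n => time (at_time (t_ n))) = t_.
    apply/cvgryPge => A; apply: filterS (nbhs_infty_ger A) => n An.
    exact: le_trans An (nt n).
  by apply/funext => n; rewrite at_timeK.
- exact: Fg.
- by move=> n s; rewrite at_timeK// => sn; apply: gN; rewrite time_ge0.
exists k; first exact: increasing_seq_ge_id.
exists y; suff <- : (fun n => (g_ (k n) \o @time R) (at_time (t_ (k n)))) =
  (fun n => g_ (k n) (t_ (k n))) by [].
by apply/funext => n /=; rewrite at_timeK.
Qed.

End real_paths.

Lemma cvg_ball_close {R : realType} {X : pseudoMetricType R} (u v : nat -> X)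
    (x : X) : u @ \oo --> x -> (forall n, ball (u n) n.+1%:R^-1 (v n)) ->
  v @ \oo --> x.
Proof.
move=> /cvg_ballP ux uv; apply/cvg_ballP => e e0.
have e20 : 0 < e / 2 by rewrite divr_gt0.
apply: filterS2 (ux _ e20) (near_infty_natSinv_lt (PosNum e20)) => n un ne.
apply: ball_split un _; apply: le_ball (uv n); exact: ltW.
Qed.

Lemma uniform_limit_cvg {R : realType} {X : pseudoMetricType R}
    (g_ : nat -> R -> X) (f : R -> X) (C r : R) (r_ : nat -> R) :
  continuous (f \o Num.max 0) ->
  (forall e : R, 0 < e -> \forall n \near \oo,
     forall s : R, 0 <= s <= C -> ball (f s) e (g_ n s)) ->
  0 <= r -> (forall n, 0 <= r_ n <= C) -> r_ @ \oo --> r ->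
  g_ n (r_ n) @[n --> \oo] --> f r.
Proof.
move=> cf gf r0 rC rr; apply/cvg_ballP => e e0.
have e20 : 0 < e / 2 by rewrite divr_gt0.
have := cvg_comp _ _ rr (cf r); rewrite /= max_r// => /cvg_ballP/(_ _ e20) fr.
apply: filterS2 fr (gf _ e20) => n /=; have /andP[rn0 _] := rC n.
by rewrite max_r// => h1 h2; apply: ball_split h1 (h2 _ (rC n)).
Qed.

(** * Limits of long trajectories in N *)

Section distance_to_set.
Context {R : realType} {X : metricType R}.
Implicit Types (A : set X) (x y : X).

(** The infimum of the empty set is 0, so the distance to the empty set is 0 and remains
    continuous. *)
Definition set_dist A x : R := inf [set mdist a x | a in A].

Let has_lbound_dist A x : has_lbound [set mdist a x | a in A].
Proof. by exists 0 => _ [a _ <-]; exact: mdist_ge0. Qed.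

Lemma set_dist_le A a x : A a -> set_dist A x <= mdist a x.
Proof. by move=> Aa; apply: ge_inf; [exact: has_lbound_dist|exists a]. Qed.

Lemma set_dist_ge0 A x : 0 <= set_dist A x.
Proof.
have [->|A0] := eqVneq A set0; first by rewrite /set_dist image_set0 inf0.
apply: lb_le_inf; last by move=> _ [a _ <-]; exact: mdist_ge0.
by apply: image_nonempty; exact/set0P.
Qed.

Lemma set_dist0 A x : A x -> set_dist A x = 0.
Proof.
move=> Ax; apply/eqP; rewrite eq_le set_dist_ge0 andbT.
by apply: le_trans (set_dist_le _ Ax) _; rewrite mdistxx.
Qed.

Lemma set_dist_ltP A x e : A !=set0 -> set_dist A x < e ->
  exists2 a, A a & ball a e x.
Proof.
move=> A0 /inf_lt-/(_ (image_nonempty _ A0))[_ [a Aa <-] ae].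
by exists a => //; rewrite ballEmdist.
Qed.

Lemma set_dist_triangle A x y : set_dist A x <= set_dist A y + mdist x y.
Proof.
have [->|A0] := eqVneq A set0.
  by rewrite /set_dist !image_set0 inf0 add0r mdist_ge0.
rewrite -lerBlDr; apply: lb_le_inf.
  by apply: image_nonempty; exact/set0P.
move=> _ [a Aa <-]; rewrite lerBlDr (metric_sym x y).
exact: le_trans (set_dist_le x Aa) (metric_triangle a y x).
Qed.

Lemma set_dist_continuous A : continuous (set_dist A).
Proof.
move=> x; apply/cvgrPdist_lt => e e0.
apply: filterS (nbhsx_ballx x e e0) => y; rewrite ballEmdist /= => xy.
apply: le_lt_trans xy; rewrite ler_norml lerBlDr lerBrDl.
have := set_dist_triangle A x y; have := set_dist_triangle A y x.
by rewrite (metric_sym y x); lra.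
Qed.

End distance_to_set.

(* The set A; it replaces the unstable set of the maximal invariant set. *)
Definition asymptotic_set {R : realType} {X : metricType R}
    (F : set (halfline R -> X)) (N : set X) : set X :=
  [set y | exists g_ : nat -> R -> X, exists2 t_ : nat -> R,
    (forall n, [/\ real_paths F (g_ n), n%:R <= t_ n & stays (g_ n) (t_ n) N]) &
    g_ n (t_ n) @[n --> \oo] --> y].

Section maximal_invariant_set.
Context {R : realType} {X : metricType R}.
Variables (F : set (halfline R -> X)) (K N : set X).
Hypotheses (Fc : F `<=` cont_halfline) (F2 : K2 F) (F3 : K3 F) (F4 : K4 F).
Hypotheses (adm : admissible F N) (KN : isolating_neighborhood F K N).

Let Ncl : closed N. Proof. by case: adm. Qed.

Let stays_closed (f : R -> X) : continuous (f \o Num.max 0) ->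
  forall (g_ : nat -> R -> X) (t : R),
  (forall e : R, 0 < e -> \forall n \near \oo,
     forall s : R, 0 <= s <= t -> ball (f s) e (g_ n s)) ->
  (\forall n \near \oo, stays (g_ n) t N) -> stays f t N.
Proof.
move=> cf g_ t gf gN s st; have /andP[s0 _] := st.
have gs : g_ n s @[n --> \oo] --> f s.
  by apply: (uniform_limit_cvg (r_ := fun=> s) cf gf s0) => //; exact: cvg_cst.
by apply: closed_cvg Ncl _ _ gs; apply: filterS gN => n; apply.
Qed.

Lemma admissible_asymptotic (g_ : nat -> R -> X) (t_ : nat -> R) :
  (forall n, [/\ real_paths F (g_ n), n%:R <= t_ n & stays (g_ n) (t_ n) N]) ->
  exists2 k : nat -> nat, (forall n, (n <= k n)%N) &
    exists2 y, asymptotic_set F N y & g_ (k n) (t_ (k n)) @[n --> \oo] --> y.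
Proof.
move=> h; have [] := @real_paths_admissible _ _ F N g_ t_ adm.
- by move=> n; have [] := h n.
- by move=> n; have [] := h n.
- by move=> n; have [] := h n.
move=> k hk [y gy]; exists k => //; exists y => //.
exists (fun n => g_ (k n)), (fun n => t_ (k n)) => // n.
have [Fg tk gN] := h (k n); split => //.
by apply: le_trans tk; rewrite ler_nat.
Qed.

Lemma stays_forever_limit (g_ : nat -> R -> X) x :
  (forall n, real_paths F (g_ n) /\ stays (g_ n) n%:R N) ->
  g_ n 0 @[n --> \oo] --> x ->
  exists2 f, real_paths F f /\ f 0 = x & forall s, 0 <= s -> N (f s).
Proof.
move=> h gx.
have [f [Ff fx [k hk kf]]] := real_paths_compactness F4 (fun n => (h n).1) gx.
exists f => // s s0.
apply: (stays_closed (real_paths_continuous Fc Ff) (kf s)); last first.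
  by rewrite s0 lexx.
apply: filterS (nbhs_infty_ger s) => n sn r /andP[r0 rs].
apply: (h (k n)).2; rewrite r0 (le_trans rs)// (le_trans sn)// ler_nat//.
Qed.

(** The long trajectories are cut one unit before their end. By admissibility the cut points
    subconverge to an asymptotic point, and (K4) applied to the final pieces yields a path from it
    to [y]. *)
Lemma asymptotic_set_backward y : asymptotic_set F N y ->
  exists p : X * (R -> X), [/\ asymptotic_set F N p.1, real_paths F p.2,
    p.2 0 = p.1, p.2 1 = y & stays p.2 1 N].
Proof.
move=> [g_ [t_ h gy]].
(* The shift to index [n.+1] keeps the shortened durations at least [n]. *)
have t1 n : 0 <= t_ n.+1 - 1.
  by rewrite subr_ge0; have [_ + _] := h n.+1; apply: le_trans; rewrite ler1n.
have h1 n : [/\ real_paths F (g_ n.+1), n%:R <= t_ n.+1 - 1 &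
    stays (g_ n.+1) (t_ n.+1 - 1) N].
  have [Fg tn gN] := h n.+1; split => //.
    by rewrite lerBrDr natr1.
  move=> s /andP[s0 st]; apply: gN; rewrite s0 (le_trans st)//.
  by rewrite gerBl.
have [k hk [z Az gz]] := admissible_asymptotic h1.
pose v n r := g_ (k n).+1 (t_ (k n).+1 - 1 + r).
have Fv n : real_paths F (v n).
  by apply: real_paths_translate => //; have [] := h (k n).+1.
have [|f [Ff fz [l hl lf]]] := real_paths_compactness F4 Fv (x := z).
  suff -> : (fun n => v n 0) = (fun n => g_ (k n).+1 (t_ (k n).+1 - 1)) by [].
  by apply/funext => n; rewrite /v addr0.
exists (z, f); split => //=.
- have v1 : v (l n) 1 @[n --> \oo] --> f 1.
    apply: (@uniform_limit_cvg _ _ (fun n => v (l n)) f 1 1 (fun=> 1)) => //.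
    + exact: (real_paths_continuous Fc Ff).
    + exact: lf.
    + by move=> _; rewrite ler01 lexx.
    + exact: cvg_cst.
  have v1y : v (l n) 1 @[n --> \oo] --> y.
    have vE : (fun n => v (l n) 1) =
        (fun n => g_ n (t_ n)) \o (fun n => (k (l n)).+1).
      by apply/funext => n; rewrite /v/= subrK.
    rewrite vE; apply: cvg_comp gy; apply: cvg_ge_id => n.
    by rewrite (leq_trans (hl n))// (leq_trans (hk _)).
  exact: (cvg_unique (@metric_hausdorff _ X) v1 v1y).
- apply: (stays_closed (real_paths_continuous Fc Ff) (lf 1)).
  apply: nearW => n r /andP[r0 r1]; rewrite /v.
  have [_ _ gN] := h (k (l n)).+1; apply: gN.
  rewrite addr_ge0 ?t1//= -lerBrDl; apply: le_trans r1 _; lra.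
Qed.

(** The piece [phi_ 0] comes directly before [f]; pieces of larger index come earlier. *)
Fixpoint prepend {R : realType} {X : Type} (phi_ : nat -> R -> X) (f : R -> X)
    (j : nat) : R -> X :=
  if j is j'.+1 then
    fun r => if r <= 1 then phi_ j' r else prepend phi_ f j' (r - 1)
  else f.

(** A backward orbit in [N], available because [f 0] is asymptotic, extends [f] to a complete
    trajectory in [N]. Its range is weakly invariant, so maximality of [K] applies. *)
Lemma asymptotic_forward_invariant f : real_paths F f ->
  asymptotic_set F N (f 0) -> (forall s, 0 <= s -> N (f s)) -> K (f 0).
Proof.
move=> Ff Af0 fN.
have /choice[P hP] : forall y, exists p : X * (R -> X), asymptotic_set F N y ->
    [/\ asymptotic_set F N p.1, real_paths F p.2,
        p.2 0 = p.1, p.2 1 = y & stays p.2 1 N].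
  move=> y.
  have [/asymptotic_set_backward[p hp]|nA] := pselect (asymptotic_set F N y).
    by exists p.
  (* Default value outside the asymptotic set, where nothing is required. *)
  by exists (y, f).
pose y_ j := iter j (fun y => (P y).1) (f 0).
have Ay j : asymptotic_set F N (y_ j) by elim: j => //= j /hP[].
(* Backward orbit pieces of unit length, taken from [asymptotic_set_backward],
   are glued in front of f; the glued paths Gam j agree after the shift by j
   and define a complete trajectory. *)
pose Gam := prepend (fun j => (P (y_ j)).2) f.
have GamE j r : Gam j.+1 r = if r <= 1 then (P (y_ j)).2 r else Gam j (r - 1).
  by [].
have GamP j : [/\ real_paths F (Gam j), Gam j 0 = y_ j &
    forall r, 0 <= r -> N (Gam j r)].
  elim: j => [|j [FG G0 GN]]; first by split.
  have [_ Fp p0 p1 pN] := hP _ (Ay j); split => /=.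
  - by apply: real_paths_concat => //; rewrite p1 -G0.
  - by rewrite GamE ler01.
  - move=> r r0; rewrite GamE; case: ifPn => [r1|].
      by apply: pN; rewrite r0.
    by rewrite -ltNge => r1; apply: GN; rewrite subr_ge0 ltW.
have GamS j r : 0 <= r -> Gam j.+1 (r + 1) = Gam j r.
  move=> r0; rewrite GamE gerDr addrK; case: ifPn => // rle0.
  have -> : r = 0 by apply/eqP; rewrite eq_le rle0 r0.
  have [_ _ _ p1 _] := hP _ (Ay j); have [_ G0 _] := GamP j.
  by rewrite add0r p1 -G0.
have GamD i j r : 0 <= r + j%:R ->
    Gam (i + j)%N (r + (i + j)%:R) = Gam j (r + j%:R).
  move=> rj; elim: i => [|i IH] //.
  rewrite addSn -natr1 addrA GamS// natrD addrCA addr_ge0//.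
have trunc_ge0 (r : R) : 0 <= r + (Num.truncn `|r|).+1%:R.
  rewrite -lerBlDr sub0r lerNl (le_trans (ler_norm _))// normrN.
  by rewrite ltW// truncnS_gt.
(* Any [j] with [0 <= r + j%:R] gives the same value ([gamE]); the truncation is one such choice. *)
pose gam r := let j := (Num.truncn `|r|).+1 in Gam j (r + j%:R).
have gamE j r : 0 <= r + j%:R -> gam r = Gam j (r + j%:R).
  move=> rj; rewrite /gam/= -(GamD j _ _ (trunc_ge0 r)) addnC GamD//.
have gamN r : N (gam r).
  by have [_ _] := GamP (Num.truncn `|r|).+1; apply; exact: trunc_ge0.
have cgam : complete_trajectory F gam.
  move=> tau; have rj := trunc_ge0 tau; set j := (Num.truncn _).+1 in rj.
  have [FG _ _] := GamP j.
  have := real_paths_translate F2 rj FG; rewrite /real_paths/=.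
  congr F; apply/funext => t /=.
  by rewrite (gamE j) addrAC// addr_ge0// time_ge0.
have [_ _ [_ _ maxK]] := KN.
apply: (maxK (range gam)) => [_ [r _ <-]|_ [r _ <-] //|].
- exists (fun t => gam (r + t)); split => [tau||t].
  + have := cgam (r + tau); congr F; apply/funext => t /=.
    by rewrite addrA.
  + by rewrite addr0.
  + by exists (r + t).
- by exists 0 => //; rewrite (gamE 0%N) ?addr0.
Qed.

Lemma invariant_set_forward x : K x ->
  exists2 f, real_paths F f /\ f 0 = x & forall s, K (f s).
Proof.
have [_ _ [Kinv _ _]] := KN.
move=> /Kinv[gam [cgam gx gK]]; exists gam => //; split => //.
have := cgam 0; rewrite /real_paths/=.
by congr F; apply/funext => t /=; rewrite add0r.
Qed.

(** Prefix [f] with the last [n] time units of a complete trajectory in [K] through [f 0]: the point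
    [f t] is then reached within [N] after time [t + n]. *)
Lemma invariant_set_asymptotic f t : real_paths F f -> K (f 0) -> 0 <= t ->
  stays f t N -> asymptotic_set F N (f t).
Proof.
have [_ _ [Kinv KsubN _]] := KN.
move=> Ff /Kinv[gam [cgam gx gK]] t0 fN.
exists (fun n r => if r <= n%:R then gam (- n%:R + r) else f (r - n%:R)).
exists (fun n => t + n%:R).
- move=> n; split.
  + apply: (@real_paths_concat _ _ F (fun r => gam (- n%:R + r))) => //.
      exact: cgam.
    by rewrite addrC subrr.
  + by rewrite lerDr.
  + move=> s /andP[s0 sn]; case: ifPn => [_|]; first exact: KsubN.
    rewrite -ltNge => ns; apply: fN; rewrite subr_ge0 (ltW ns)/=.
    by rewrite lerBlDr.
- rewrite (_ : (fun n => _) = (fun=> f t)); first exact: cvg_cst.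
  apply/funext => n; rewrite addrK gerDr; case: ifPn => // tle0.
  have -> : t = 0 by apply/eqP; rewrite eq_le tle0.
  by rewrite add0r addNr.
Qed.

(** Otherwise ever longer stays in [N] would end at distance at least [e]; by admissibility these
    endpoints subconverge to an asymptotic point, at distance 0. *)
Lemma set_dist_asymptotic_decay e : 0 < e ->
  exists2 T : R, 0 <= T & forall f t, real_paths F f -> T <= t ->
    stays f t N -> set_dist (asymptotic_set F N) (f t) < e.
Proof.
move=> e0; apply: contrapT => hno.
have /choice[p hp] : forall n : nat, exists p : (R -> X) * R,
    [/\ real_paths F p.1, n%:R <= p.2 & stays p.1 p.2 N] /\
    e <= set_dist (asymptotic_set F N) (p.1 p.2).
  move=> n; apply: contrapT => hn; apply: hno; exists n%:R => // f t Ff nt fN.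
  by rewrite ltNge; apply/negP => h; apply: hn; exists (f, t).
have [k hk [y Ay gy]] := admissible_asymptotic (fun n => (hp n).1).
have := cvg_comp _ _ gy (@set_dist_continuous _ _ (asymptotic_set F N) y).
rewrite set_dist0// => /cvgr_lt/(_ _ e0)[n _ /(_ n (leqnn n))/=].
by rewrite ltNge (hp (k n)).2.
Qed.

(** If this failed, points outside [V] with ever longer stays in [N] would approach the asymptotic
    set. A limit point is asymptotic and has a forward trajectory in [N], hence lies in [K],
    although the complement of [V] is closed. *)
Lemma isolating_estimate (V : set X) : K !=set0 -> open V -> K `<=` V ->
  exists2 e : R, 0 < e & exists T : nat, forall f, real_paths F f ->
    stays f T%:R N -> set_dist (asymptotic_set F N) (f 0) < e -> V (f 0).
Proof.
move=> [x Kx] oV KV; apply: contrapT => hno.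
have A0 : asymptotic_set F N !=set0.
  have [f [Ff f0] fK] := invariant_set_forward Kx.
  exists (f 0); apply: invariant_set_asymptotic => // s _.
  by have [_ _ [_ + _]] := KN; apply.
(* Half of the tolerance goes to approximating [f 0] by an asymptotic point, half to approximating
   that point by the end of a long trajectory. *)
pose r n : R := n.+1%:R^-1 / 2.
have r0 n : 0 < r n by rewrite divr_gt0.
have /choice[p hp] : forall n : nat, exists p : (R -> X) * ((R -> X) * R),
    [/\ real_paths F p.1, stays p.1 n%:R N & ~ V (p.1 0)] /\
    [/\ real_paths F p.2.1, n%:R <= p.2.2 & stays p.2.1 p.2.2 N] /\
    ball (p.2.1 p.2.2) n.+1%:R^-1 (p.1 0).
  move=> n; apply: contrapT => hn; apply: hno; exists (r n) => //; exists n.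
  move=> f Ff fN /(set_dist_ltP A0)[a [g_ [t_ ha gta]] fa].
  apply: contrapT => nVf; apply: hn.
  have /cvg_ballP/(_ _ (r0 n))[m _ hm] := gta.
  have mM : (m <= maxn m n)%N by rewrite leq_maxl.
  have [Fg tg gN] := ha (maxn m n).
  exists (f, (g_ (maxn m n), t_ (maxn m n))); split => //; split => /=.
    by split => //; apply: le_trans tg; rewrite ler_nat leq_maxr.
  exact: (ball_split (ball_sym (hm _ mM)) fa).
have [k hk [y Ay gy]] := admissible_asymptotic (fun n => (hp n).2.1).
have fy : (p (k n)).1 0 @[n --> \oo] --> y.
  apply: cvg_ball_close gy _ => n; apply: le_ball (hp (k n)).2.2.
  by rewrite lef_pV2 ?posrE// ler_nat ltnS.
have [|f [Ff f0] fN] := stays_forever_limit (g_ := fun n => (p (k n)).1) _ fy.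
  move=> n; have [[Fp pN _] _] := hp (k n); split => // s /andP[s0 sn].
  by apply: pN; rewrite s0 (le_trans sn)// ler_nat.
have : K (f 0) by apply: asymptotic_forward_invariant => //; rewrite f0.
rewrite f0 => /KV.
apply: (@closed_cvg _ _ _ _ _ (~` V) (open_closedC oV) _ _ fy).
by apply: nearW => n; have [[]] := hp (k n).
Qed.

End maximal_invariant_set.

(** * Monotone quantities along trajectories *)

(** At the first exit time [tau] from [U], the point [f tau] is outside [U] because [U] is open; but
    it is a left limit of points of [C], hence in [C] and in [U]. *)
Lemma open_closed_forward {R : realType} {X : topologicalType} (f : R -> X)
    (U C : set X) : continuous (f \o Num.max 0) ->
  open U -> closed C -> C `<=` U -> U (f 0) ->
  (forall r, 0 <= r -> (forall s, 0 <= s <= r -> U (f s)) -> C (f r)) ->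
  forall r, 0 <= r -> U (f r).
Proof.
move=> cf oU cC CU Uf0 h r1 r10; apply: contrapT => nU1.
pose S := [set r | 0 <= r /\ ~ U (f r)].
have Slb : has_lbound S by exists 0 => r [].
have Sinf : has_inf S by split => //; exists r1.
set tau := inf S.
have tau0 : 0 <= tau by apply: lb_le_inf => [|r []//]; exists r1.
have Ult s : 0 <= s -> s < tau -> U (f s).
  move=> s0 st; apply: contrapT => nUs; move: st; rewrite ltNge => /negP; apply.
  by apply: (@ge_inf _ S) => //; split.
have nUtau : ~ U (f tau).
  move=> Utau; have := cf tau; move=> /(_ U); rewrite /= max_r//.
  move=> /(_ (open_nbhs_nbhs (conj oU Utau)))/nbhs_ballP[d /= d0 dU].
  have [r [r0 nUr] rd] := inf_adherent d0 Sinf.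
  apply: (nUr); have := dU r; rewrite /= max_r//; apply.
  have tr : tau <= r by apply: (@ge_inf _ S).
  by rewrite /ball/= distrC ger0_norm ?subr_ge0// ltrBlDl.
have {}tau0 : 0 < tau.
  by rewrite lt_neqAle tau0 andbT; apply/eqP => t0; apply: nUtau; rewrite -t0.
apply: nUtau; apply: CU.
have := cvg_at_left_filter (cf tau); rewrite /= (max_r (ltW tau0)) => ft.
apply: closed_cvg cC _ _ ft; near=> s => /=.
have s0 : 0 < s by near: s; exact: nbhs_left_gt.
rewrite max_r ?ltW//; apply: h => [|r /andP[r0 rs]]; first exact: ltW.
by apply: Ult => //; apply: le_lt_trans rs _; near: s; exact: nbhs_left_lt.
Unshelve. all: by end_near. Qed.

(* With h = 1 and a t = 1 + t, respectively h = dist(., A) and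
   a t = 2 - 1 / (1 + t), this says that m is at most one of the expressions
   whose suprema are p(x) and q(x). *)
Definition attains {R : realType} {X : metricType R}
    (F : set (halfline R -> X)) (Q : X -> R) (a : R -> R) (h : X -> R)
    (t m : R) (x : X) : Prop :=
  exists f, [/\ real_paths F f, f 0 = x &
    forall r, 0 <= r <= t -> m <= a t * h (f t) * Q (f r)].

Section gauges.
Context {R : realType} {X : metricType R}.
Variables (F : set (halfline R -> X)) (Q : X -> R) (a : R -> R) (h : X -> R).
Hypotheses (Fc : F `<=` cont_halfline).
Hypotheses (Qc : continuous Q) (hc : continuous h).
Hypotheses (Q1 : forall x, 0 <= Q x <= 1) (h0 : forall x, 0 <= h x).
Hypotheses (a0 : forall t, 0 <= t -> 0 < a t).

Let w_ge0 t x : 0 <= t -> 0 <= a t * h x.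
Proof. by move=> t0; rewrite mulr_ge0// ltW// a0. Qed.

Lemma attains_le t m m' x : m' <= m -> attains F Q a h t m x ->
  attains F Q a h t m' x.
Proof.
move=> mm [f [Ff f0 fm]]; exists f; split => // r rt.
exact: le_trans mm (fm r rt).
Qed.

Lemma attains_stays t m x : 0 <= t -> 0 < m -> attains F Q a h t m x ->
  exists f, [/\ real_paths F f, f 0 = x, m <= a t * h (f t) &
    stays f t [set y | 0 < Q y]].
Proof.
move=> t0 m0 [f [Ff f0 fm]]; exists f; split => //.
- have := fm 0; rewrite lexx t0 => /(_ isT) fm0; apply: le_trans fm0 _.
  by rewrite ler_piMr ?w_ge0//; have /andP[] := Q1 (f 0).
- move=> r rt /=; rewrite lt_neqAle; have /andP[-> _] := Q1 (f r).
  rewrite andbT; apply/eqP => Q0; have := fm r rt.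
  by rewrite -Q0 mulr0 leNgt m0.
Qed.

(** Running [f] first does not lower the minimum, since [Q] has its maximal value there, but it
    lengthens the time, so [m] grows by the ratio of the weights. *)
Lemma attains_before (f : R -> X) s t m : K3 F -> 0 < s -> 0 <= t -> 0 < m ->
  (forall t s, 0 <= t -> t < s -> a t < a s) ->
  real_paths F f -> (forall r, 0 <= r <= s -> Q (f r) = 1) ->
  attains F Q a h t m (f s) ->
  exists2 m', m < m' & attains F Q a h (s + t) m' (f 0).
Proof.
move=> F3 s0 t0 m0 ai Ff Qf [g [Fg g0 gm]].
have at0 := a0 t0.
exists (m * (a (s + t) / a t)).
  by rewrite ltr_pMr// ltr_pdivlMr// mul1r ai// ltrDr.
exists (fun r => if r <= s then f r else g (r - s)); split.
- by apply: real_paths_concat => //; exact: ltW.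
- by rewrite ltW.
move=> r /andP[r0 rst].
have -> : (if s + t <= s then f (s + t) else g (s + t - s)) = g t.
  rewrite gerDl [s + t]addrC addrK; case: ifPn => // tle0.
  have -> : t = 0 by apply/eqP; rewrite eq_le tle0.
  by rewrite add0r g0.
have ha : 0 <= a (s + t) / a t by rewrite divr_ge0// ltW// a0// addr_ge0// ltW.
suff H : m <= a t * h (g t) * Q (if r <= s then f r else g (r - s)).
  have -> : a (s + t) * h (g t) = a t * h (g t) * (a (s + t) / a t).
    by field; rewrite gt_eqF.
  by rewrite mulrAC ler_wpM2r.
have [rs|sr] := leP r s.
  rewrite Qf ?r0//; have := gm 0; rewrite lexx t0 => /(_ isT) gm0.
  apply: le_trans gm0 _; rewrite ler_wpM2l ?w_ge0//.
  by have /andP[] := Q1 (g 0).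
by apply: gm; rewrite subr_ge0 ltW//= lerBlDl.
Qed.

Lemma attains_limit (g_ : nat -> R -> X) (t_ : nat -> R) C m x : K4 F ->
  (forall t, 0 <= t -> {for t, continuous a}) ->
  (forall n, real_paths F (g_ n)) -> (forall n, 0 <= t_ n <= C) ->
  (forall n r, 0 <= r <= t_ n ->
     m <= a (t_ n) * h (g_ n (t_ n)) * Q (g_ n r)) ->
  g_ n 0 @[n --> \oo] --> x ->
  exists2 t, 0 <= t & attains F Q a h t m x.
Proof.
move=> F4 ac Fg tC gm gx.
have [k [t /andP[t0 tC'] [hk kt]]] := bounded_cvg_subseq tC.
have gkx : g_ (k n) 0 @[n --> \oo] --> x by exact: cvg_comp (cvg_ge_id hk) gx.
have [f [Ff fx [l hl lf]]] := real_paths_compactness F4 (fun n => Fg (k n)) gkx.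
have cf := real_paths_continuous Fc Ff.
exists t => //; exists f; split => // r /andP[r0 rt].
have klt : t_ (k (l n)) @[n --> \oo] --> t by exact: cvg_comp (cvg_ge_id hl) kt.
pose v n := g_ (k (l n)); pose u n := t_ (k (l n)).
have gt : v n (u n) @[n --> \oo] --> f t.
  by apply: (uniform_limit_cvg cf (lf C) t0) => // n; exact: tC.
(* The bound along the sequence is known only up to time [u n], which may be smaller than [r]. *)
have rr : Num.min r (u n) @[n --> \oo] --> r.
  rewrite -[X in _ --> X](min_l rt).
  apply: cvg_comp klt _.
  by apply: (@continuous_min R R (cst r) id t); [exact: cvg_cst|exact: cvg_id].
have gr : v n (Num.min r (u n)) @[n --> \oo] --> f r.
  apply: (uniform_limit_cvg cf (lf C) r0) => // n.
  have /andP[u0 uC] := tC (k (l n)).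
  by rewrite le_min r0 u0/= ge_min uC orbT.
have lim : a (u n) * h (v n (u n)) * Q (v n (Num.min r (u n))) @[n --> \oo] -->
    a t * h (f t) * Q (f r).
  apply: cvgM; first apply: cvgM.
  - exact: continuous_cvg (ac t t0) klt.
  - exact: continuous_cvg (@hc (f t)) gt.
  - exact: continuous_cvg (@Qc (f r)) gr.
rewrite -(cvg_lim _ lim)//; apply: limr_ge.
  by apply/cvg_ex; eexists; exact: lim.
apply: nearW => n; apply: gm; have /andP[u0 uC] := tC (k (l n)).
by rewrite le_min r0 u0/= ge_min lexx orbT.
Qed.

(** As [m] is positive, [f] stays where [Q] is positive, hence in [W]. From a sequence of
    counterexamples, [paths_lsc] gives paths close to [f] on [[0, t]] that violate the bound [m'];
    at a limit of the violating times, [f] gives at most [m'], less than [m]. *)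
Lemma attains_nbhs (W : set X) t m m' x :
  paths_lsc F W ->
  (forall y, 0 < Q y -> W y) ->
  0 <= t -> 0 < m -> m' < m -> attains F Q a h t m x ->
  \forall y \near x, attains F Q a h t m' y.
Proof.
move=> lsc QW t0 m0 m'm atm.
apply: contrapT => /not_nbhs_seq[u nu ux].
have [f [Ff f0 fm]] := atm; have cf := real_paths_continuous Fc Ff.
have fW : stays f t W.
  move=> s /andP[s0 st]; apply: QW; rewrite lt_neqAle.
  have /andP[-> _] := Q1 (f s); rewrite andbT; apply/eqP => Q0.
  by have := fm s; rewrite s0 st => /(_ isT); rewrite -Q0 mulr0 leNgt m0.
rewrite -f0 in ux.
have [k hk [g_ gP gf]] := lsc f u t t0 Ff fW ux.
have /choice[r_ hr] : forall n, exists r, 0 <= r <= t /\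
    a t * h (g_ n t) * Q (g_ n r) < m'.
  move=> n; apply: contrapT => hn; apply: (nu (k n)); have [Fg gu] := gP n.
  exists (g_ n); split => // r rt; rewrite leNgt; apply/negP => hr.
  by apply: hn; exists r.
have [l [r /andP[r0 rt] [hl lr]]] := bounded_cvg_subseq (fun n => (hr n).1).
have glf e : 0 < e -> \forall n \near \oo,
    forall s : R, 0 <= s <= t -> ball (f s) e (g_ (l n) s).
  by move=> /gf; exact: cvg_ge_id hl _.
have gt : g_ (l n) t @[n --> \oo] --> f t.
  apply: (@uniform_limit_cvg _ _ (fun n => g_ (l n)) f t t (fun=> t)) => //.
    by move=> _; rewrite t0 lexx.
  exact: cvg_cst.
have gr : g_ (l n) (r_ (l n)) @[n --> \oo] --> f r.
  apply: (@uniform_limit_cvg _ _ (fun n => g_ (l n)) f t r (r_ \o l)) => //.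
  by move=> n; exact: (hr (l n)).1.
have lim : a t * h (g_ (l n) t) * Q (g_ (l n) (r_ (l n))) @[n --> \oo] -->
    a t * h (f t) * Q (f r).
  apply: cvgM; first apply: cvgM; first exact: cvg_cst.
  - exact: continuous_cvg (@hc (f t)) gt.
  - exact: continuous_cvg (@Qc (f r)) gr.
have : m <= a t * h (f t) * Q (f r) by apply: fm; rewrite r0 rt.
apply/negP; rewrite -ltNge; apply: le_lt_trans m'm.
rewrite -(cvg_lim _ lim)//; apply: limr_le.
  by apply/cvg_ex; eexists; exact: lim.
by apply: nearW => n; exact: ltW (hr (l n)).2.
Qed.

End gauges.

(** * Isolating blocks *)

Lemma trajectory_from_start {R : realType} {X : metricType R}
    (F : set (halfline R -> X)) phi : F phi ->
  trajectory_through F (start phi) 0 (phi \o @at_time R).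
Proof.
move=> Fphi; split => //; have := real_paths_at_time Fphi.
rewrite /real_paths/=; congr F; apply/funext => t /=.
by rewrite oppr0 add0r.
Qed.

(** (K1) provides a trajectory starting at [x], which would have to be both inside and outside [B]
    right after time 0. *)
Lemma exit_ingress_disjoint {R : realType} {X : metricType R}
    (F : set (halfline R -> X)) (B : set X) x :
  K1 F -> exit_set F B x -> ingress F B x -> False.
Proof.
move=> F1 xe [xb xi]; have [phi Fphi phix] := F1 x.
have tr := trajectory_from_start Fphi; rewrite phix in tr.
set f := _ \o _ in tr.
have [[e1 e10 h1] _] := xi _ _ tr.
have [e2 e20 h2] : right_after f (~` B).
  by case: xe => -[_ /(_ _ _ tr)[]].
have e0 : 0 < Num.min e1 e2 by rewrite lt_min e10.
apply: (h2 (Num.min e1 e2)); first by rewrite e0 ge_min lexx orbT.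
by apply: interior_subset; apply: h1; rewrite e0 ge_min lexx.
Qed.

Lemma isolating_block_sub {R : realType} {X : metricType R}
    (F Ft : set (halfline R -> X)) (K Kt N B : set X) :
  F `<=` Ft -> K1 F -> K `<=` Kt -> maximal_weakly_invariant_in F K N ->
  B `<=` N -> isolating_block Ft Kt B -> isolating_block F K B.
Proof.
move=> FFt F1 KKt [Kinv _ Kmax] BN [Bcl [_ KtB _] bB exB].
have KB : K `<=` B° by exact: subset_trans KtB.
have trS x delta sigma :
    trajectory_through F x delta sigma -> trajectory_through Ft x delta sigma.
  by move=> [? /FFt ? ?]; split.
have exS : exit_set Ft B `<=` exit_set F B.
  move=> x [[bx xe]|[bx xe]]; [left|right];
    by split => // delta sigma /trS/xe.
have inS : ingress Ft B `<=` ingress F B.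
  by move=> x [bx xi]; split => // delta sigma /trS/xi.
have subb : exit_set F B `|` ingress F B `<=` boundary B.
  by move=> x [[[]|[]]|[]].
have bB' : boundary B = exit_set F B `|` ingress F B.
  apply/seteqP; split => // x; rewrite bB => -[/exS|/inS]; by [left|right].
split => //.
- split => //; split => // [|A' A'inv A'B].
    exact: subset_trans KB (@interior_subset _ _).
  by apply: Kmax => //; exact: subset_trans BN.
(* An exit point for [F] that is not one for [Ft] would be an ingress point for [Ft], hence for [F],
   against disjointness. *)
- suff <- : exit_set Ft B = exit_set F B by [].
  apply/seteqP; split => // x xF.
  have : boundary B x by apply: subb; left.
  by rewrite bB => -[//|/inS/(exit_ingress_disjoint F1 xF)].
Qed.

(** Settles the case of an empty [Kt]; the construction below starts from a nonempty invariant
    set. *)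
Lemma isolating_block_set0 {R : realType} {X : metricType R}
    (F : set (halfline R -> X)) : isolating_block F set0 (set0 : set X).
Proof.
have b0 : boundary (set0 : set X) = set0 by rewrite /boundary closure0 set0D.
have e0 : exit_set F (set0 : set X) = set0.
  by rewrite -subset0 => x [[]|[]]; rewrite b0.
split.
- exact: closed0.
- by split => //; [exact: closed0|split => // x []].
- rewrite e0 b0 set0U; apply/esym; rewrite -subset0 => x [].
  by rewrite b0.
- by rewrite e0; exact: closed0.
Qed.

Lemma urysohn_open_nbhs {R : realType} {X : metricType R} (K W : set X) :
  closed K -> open W -> K `<=` W ->
  exists g : X -> R, [/\ continuous g, forall x, K x -> g x = 0 &
    forall x, g x < 1 -> W x].
Proof.
move=> Kcl oW KW.
have KW0 : K `&` ~` W = set0 by apply/disjoints_subset; rewrite setCK.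
have /(@normal_separatorP R)/(_ K (~` W) Kcl (open_closedC oW) KW0) :=
  @pseudometric_normal R X.
move=> /(@uniform_separatorP _ R)[g [gc g01 gK gW]].
exists g; split => //.
- by move=> x Kx; apply: gK; exists x.
- move=> x gx; apply: contrapT => nW.
  have : g x = 1 by apply: gW; exists x.
  by move=> g1; move: gx; rewrite g1 ltxx.
Qed.

(** The weight of [p]. Being unbounded, it makes [p] infinite at points with a forward trajectory in
    [V]. *)
Lemma growing_weight {R : realType} :
  [/\ forall t : R, 0 <= t -> 0 < 1 + t,
      forall t s : R, 0 <= t -> t < s -> 1 + t < 1 + s &
      forall t : R, 0 <= t -> {for t, continuous (fun t : R => 1 + t)}].
Proof.
split=> [t t0|t s _ ts|t _]; first by rewrite ltr_pwDl.
- by rewrite ltrD2l.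
- by apply: cvgD; [exact: cvg_cst|exact: cvg_id].
Qed.

(** The weight of [q]. It starts at 1, so [q] dominates the distance on [V], and stays below 2, so
    late times contribute little. *)
Lemma bounded_weight {R : realType} :
  [/\ forall t : R, 0 <= t -> 0 < 2 - (1 + t)^-1,
      forall t s : R, 0 <= t -> t < s -> 2 - (1 + t)^-1 < 2 - (1 + s)^-1 &
      forall t : R, 0 <= t ->
        {for t, continuous (fun t : R => 2 - (1 + t)^-1)}].
Proof.
split=> [t t0|t s t0 ts|t t0].
- have : (1 + t)^-1 <= 1 by rewrite invf_le1 ?lerDl// ltr_pwDl.
  lra.
- have t1 : 0 < 1 + t by rewrite ltr_pwDl.
  have s1 : 0 < 1 + s by rewrite ltr_pwDl// ltW// (le_lt_trans t0).
  by rewrite ltrD2l ltrN2 ltf_pV2// ltrD2l.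
- apply: cvgB; first exact: cvg_cst.
  apply: cvgV; first by rewrite gt_eqF// ltr_pwDl.
  by apply: cvgD; [exact: cvg_cst|exact: cvg_id].
Qed.

(** * Construction of the block from the cut-off function *)

Section block.
Context {R : realType} {X : metricType R}.
Variables (F : set (halfline R -> X)) (K N W : set X) (g : X -> R).
Hypotheses (Fc : F `<=` cont_halfline) (F1 : K1 F).
Hypotheses (F2 : K2 F) (F3 : K3 F) (F4 : K4 F).
Hypotheses (adm : admissible F N) (KN : isolating_neighborhood F K N).
Hypothesis lsc : paths_lsc F W.
Hypotheses (gc : continuous g).
Hypotheses (gK : forall x, K x -> g x = 0).
Hypotheses (gN : forall x, g x < 1 -> N x) (gW : forall x, g x < 1 -> W x).
Hypothesis K0 : K !=set0.

(** [Q] is 1 where [g] is at most 1/2, in particular on [V], and 0 where [g] is at least 1; [V1] is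
    a smaller neighborhood of [K] whose closure lies in [V]. *)
Let Q x : R := Num.max 0 (Num.min 1 (2 - 2 * g x)).
Let V := [set x | g x < 2^-1].
Let V1 := [set x | g x < 4^-1].

Let Qc : continuous Q.
Proof.
move=> x; apply: (@continuous_max R X (cst 0)); first exact: cvg_cst.
apply: (@continuous_min R X (cst 1)); first exact: cvg_cst.
apply: cvgB; first exact: cvg_cst.
by apply: cvgM; [exact: cvg_cst|exact: gc].
Qed.

Let Q01 x : 0 <= Q x <= 1.
Proof. by rewrite /Q le_max lexx/= ge_max ler01/= ge_min lexx. Qed.

Let QV x : V x -> Q x = 1.
Proof.
rewrite /V/= => gx; have h : 1 <= 2 - 2 * g x by lra.
by rewrite /Q (min_l h) max_r.
Qed.

Let Q_gt0 x : 0 < Q x -> g x < 1.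
Proof. by rewrite /Q lt_max ltxx/= lt_min ltr01/=; lra. Qed.

Let Vopen : open V.
Proof.
exact: (@open_comp _ _ g [set x | x < 2^-1] (fun x _ => @gc x) (@open_lt _ _)).
Qed.

Let V1open : open V1.
Proof.
exact: (@open_comp _ _ g [set x | x < 4^-1] (fun x _ => @gc x) (@open_lt _ _)).
Qed.

Let V1V : closure V1 `<=` V.
Proof.
move=> x V1x; have cl : closed [set x | g x <= 4^-1].
  exact: (@closed_comp _ _ g [set x | x <= 4^-1] (fun x _ => @gc x)
    (@closed_le _ _)).
have : g x <= 4^-1.
  suff : [set x | g x <= 4^-1] x by [].
  by rewrite ((closure_id _).1 cl); apply: closureS V1x => y; exact: ltW.
rewrite /V/=; lra.
Qed.

Let dist := set_dist (asymptotic_set F N).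
(** The suprema, possibly infinite, are never formed: [p m x] says that some trajectory attains at
    least [m]. A supremum above [M] becomes attainment of some [m] above [M], and one at most [eps]
    becomes non-attainment of every [m] above [eps]. *)
Let p m x := exists2 t, 0 <= t & attains F Q (fun t => 1 + t) (fun=> 1) t m x.
Let q m x :=
  exists2 t, 0 <= t & attains F Q (fun t => 2 - (1 + t)^-1) dist t m x.

Let h1c : continuous ((fun=> 1) : X -> R).
Proof. by move=> x; exact: cvg_cst. Qed.

Let h1_ge0 (x : X) : 0 <= 1 :> R.
Proof. exact: ler01. Qed.

Let p_nbhs m m' x : 0 < m -> m' < m -> p m x -> \forall y \near x, p m' y.
Proof.
have [a0 _ _] := @growing_weight R.
move=> m0 mm [t t0 pt].
have := attains_nbhs (W := W) Fc Qc h1c Q01 lsc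
  (fun x Qx => gW (Q_gt0 Qx)) t0 m0 mm pt.
by apply: filterS => y ?; exists t.
Qed.

Let q_nbhs m m' x : 0 < m -> m' < m -> q m x -> \forall y \near x, q m' y.
Proof.
have [a0 _ _] := @bounded_weight R.
move=> m0 mm [t t0 qt].
have := attains_nbhs (W := W) Fc Qc (@set_dist_continuous _ _ _) Q01
  lsc (fun x Qx => gW (Q_gt0 Qx)) t0 m0 mm qt.
by apply: filterS => y ?; exists t.
Qed.

Let p_before m s (f : R -> X) : 0 < m -> 0 < s -> real_paths F f ->
  (forall r, 0 <= r <= s -> V (f r)) -> p m (f s) ->
  exists2 m', m < m' & p m' (f 0).
Proof.
have [a0 ai _] := @growing_weight R.
move=> m0 s0 Ff fV [t t0 pt].
have [m' mm' am'] := attains_before Q01 h1_ge0 a0 F3 s0 t0 m0 ai Ff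
  (fun r rs => QV (fV r rs)) pt.
by exists m' => //; exists (s + t) => //; rewrite addr_ge0// ltW.
Qed.

Let q_before m s (f : R -> X) : 0 < m -> 0 < s -> real_paths F f ->
  (forall r, 0 <= r <= s -> V (f r)) -> q m (f s) ->
  exists2 m', m < m' & q m' (f 0).
Proof.
have [a0 ai _] := @bounded_weight R.
move=> m0 s0 Ff fV [t t0 qt].
have [m' mm' am'] := attains_before Q01 (set_dist_ge0 _) a0 F3 s0 t0 m0 ai Ff
  (fun r rs => QV (fV r rs)) qt.
by exists m' => //; exists (s + t) => //; rewrite addr_ge0// ltW.
Qed.

Let p_le m m' x : m' <= m -> p m x -> p m' x.
Proof. by move=> mm [t t0 /(attains_le mm)pt]; exists t. Qed.

Let q_le m m' x : m' <= m -> q m x -> q m' x.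
Proof. by move=> mm [t t0 /(attains_le mm)qt]; exists t. Qed.

Let p_forever m f : 0 <= m -> real_paths F f -> (forall r, 0 <= r -> V (f r)) ->
  p m (f 0).
Proof.
move=> m0 Ff fV; exists m => //; exists f; split => // r /andP[r0 _].
by rewrite QV ?mulr1 ?lerDr//; exact: fV.
Qed.

Let q_dist x : V x -> q (dist x) x.
Proof.
move=> Vx; have [phi Fphi phix] := F1 x; exists 0 => //.
have f0 : (phi \o @at_time R) 0 = x by [].
exists (phi \o @at_time R); split => // [|r]; first exact: real_paths_at_time.
rewrite -eq_le => /eqP<-; rewrite f0 QV// mulr1 addr0 invr1.
by rewrite (_ : 2 - 1 = 1 :> R) ?mul1r//; lra.
Qed.

Let p_stays m x : 0 < m -> p m x ->
  exists f t, [/\ real_paths F f, f 0 = x, 0 <= t, m <= 1 + t & stays f t N].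
Proof.
have [a0 _ _] := @growing_weight R.
move=> m0 [t t0 pt].
have [f [Ff f0 fm fQ]] := attains_stays Q01 h1_ge0 a0 t0 m0 pt.
by exists f, t; split => // [|r /fQ/Q_gt0/gN//]; rewrite mulr1 in fm.
Qed.

Let q_stays m x : 0 < m -> q m x ->
  exists f t,
    [/\ real_paths F f, f 0 = x, 0 <= t, m <= 2 * dist (f t) & stays f t N].
Proof.
have [a0 _ _] := @bounded_weight R.
move=> m0 [t t0 qt].
have [f [Ff f0 fm fQ]] := attains_stays Q01 (set_dist_ge0 _) a0 t0 m0 qt.
exists f, t; split => // [|r /fQ/Q_gt0/gN//]; apply: le_trans fm _.
by rewrite ler_wpM2r ?set_dist_ge0// gerBl invr_ge0 ltW// ltr_pwDl.
Qed.

(** The times of attainment are bounded because the distance decays along long stays in [N], so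
    [attains_limit] applies. *)
Let q_closed m x : 0 < m -> ~ q m x -> \forall y \near x, ~ q m y.
Proof.
have [a0 _ ac] := @bounded_weight R.
move=> m0 nq; apply: contrapT => /not_nbhs_seq[u nu ux]; apply: nq.
(* The weight of [q] is below 2, so [m] cannot be attained where [dist] is under [m / 2]. *)
have m20 : 0 < m / 2 by rewrite divr_gt0.
have [T T0 hT] := set_dist_asymptotic_decay adm m20.
have /choice[P hP] : forall n, exists P : (R -> X) * R,
    [/\ real_paths F P.1, P.1 0 = u n, 0 <= P.2 <= T &
    forall r, 0 <= r <= P.2 ->
      m <= (2 - (1 + P.2)^-1) * dist (P.1 P.2) * Q (P.1 r)].
  move=> n; have /contrapT[t t0 qt] := nu n.
  have [f [Ff f0 fm]] := qt; exists (f, t); split => //=; rewrite t0/=.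
  rewrite leNgt; apply/negP => Tt.
  have fQ r : 0 <= r <= t -> 0 < Q (f r).
    move=> rt; have := fm r rt.
    rewrite lt_neqAle; have /andP[-> _] := Q01 (f r).
    by rewrite andbT => h; apply/eqP => Q0; move: h; rewrite -Q0 mulr0 leNgt m0.
  have := hT f t Ff (ltW Tt) (fun r rt => gN (Q_gt0 (fQ r rt))).
  have d0 := set_dist_ge0 (asymptotic_set F N) (f t).
  have /andP[Q0 Q1] := Q01 (f 0).
  have := fm 0; rewrite lexx t0 => /(_ isT) h.
  have {}h : m <= (2 - (1 + t)^-1) * dist (f t).
    by apply: le_trans h _; rewrite ler_piMr// mulr_ge0// ltW// a0.
  have {}h : m <= 2 * dist (f t).
    apply: le_trans h _; rewrite ler_wpM2r// gerBl invr_ge0 ltW// ltr_pwDl//.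
  move: h; rewrite -/dist; lra.
apply: (attains_limit Fc Qc (@set_dist_continuous _ _ _) (C := T)
  (g_ := fun n => (P n).1) (t_ := fun n => (P n).2) F4 ac).
- by move=> n; have [] := hP n.
- by move=> n; have [] := hP n.
- by move=> n; have [] := hP n.
- by rewrite (_ : (fun n => _) = u)//; apply/funext => n; have [] := hP n.
Qed.

Let K_V1 : K `<=` V1.
Proof. by move=> x Kx; rewrite /V1/= gK. Qed.

Let V1_V : V1 `<=` V.
Proof. exact: subset_trans (@subset_closure _ _) V1V. Qed.

Let V_N : V `<=` N.
Proof. move=> x Vx; apply: gN; move: Vx; rewrite /V/=; lra. Qed.

Section trajectory.
Variables (x : X) (delta : R) (sigma : R -> X).
Hypothesis tr : trajectory_through F x delta sigma.

Let sigma_path s : - delta <= s -> real_paths F (fun r => sigma (s + r)).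
Proof.
move=> ds; have [_ Fs _] := tr.
have ds0 : 0 <= s + delta by lra.
have := real_paths_translate (f := fun r => sigma (- delta + r)) F2 ds0 Fs.
by congr (real_paths F); apply/funext => r; congr sigma; ring.
Qed.

Lemma trajectory_near (P : X -> Prop) : (\forall y \near x, P y) ->
  exists2 d : R, 0 < d & forall t, - delta <= t -> - d <= t <= d -> P (sigma t).
Proof.
move=> xP; have [d0 Fs s0] := tr.
have := real_paths_continuous (f := fun r => sigma (- delta + r)) Fc Fs
  (x := delta).
move=> /(_ P); rewrite /= max_r// addNr s0 => /(_ xP)/nbhs_ballP[d /= d_gt0 dP].
exists (d / 2); first by rewrite divr_gt0.
move=> t dt td; have := dP (t + delta); rewrite /= max_r; last by lra.
rewrite [t + delta]addrC addKr; apply; rewrite /ball/= opprD addrA subrr sub0r.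
by rewrite normrN ltr_norml; lra.
Qed.

Lemma p_trajectory m s t : 0 < m -> - delta <= s -> s < t ->
  (forall r, s <= r <= t -> V (sigma r)) -> p m (sigma t) ->
  exists2 m', m < m' & p m' (sigma s).
Proof.
move=> m0 ds st sV pt; have ts : 0 < t - s by rewrite subr_gt0.
have E : s + (t - s) = t by rewrite addrC subrK.
have := p_before m0 ts (sigma_path ds); rewrite E addr0; apply => //.
by move=> r /andP[r0 rs]; apply: sV; rewrite lerDl r0 -lerBrDl.
Qed.

Lemma q_trajectory m s t : 0 < m -> - delta <= s -> s < t ->
  (forall r, s <= r <= t -> V (sigma r)) -> q m (sigma t) ->
  exists2 m', m < m' & q m' (sigma s).
Proof.
move=> m0 ds st sV qt; have ts : 0 < t - s by rewrite subr_gt0.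
have E : s + (t - s) = t by rewrite addrC subrK.
have := q_before m0 ts (sigma_path ds); rewrite E addr0; apply => //.
by move=> r /andP[r0 rs]; apply: sV; rewrite lerDl r0 -lerBrDl.
Qed.

End trajectory.

Lemma isolating_block_of_plateau : exists2 B, B `<=` N & isolating_block F K B.
Proof.
have [e e0 [T hT]] := isolating_estimate Fc F2 F3 F4 adm KN K0 V1open K_V1.
(* Points of [V] with [dist] at least [e] attain values of [q] above [eps], by [q_dist]; attaining
   [M] for [p] forces a stay in [N] of length at least [T]. *)
pose eps := e / 2; have eps0 : 0 < eps by rewrite divr_gt0.
pose M : R := T%:R + 1; have M0 : 0 < M by rewrite ltr_wpDl.
have good_V1 f : real_paths F f -> stays f T%:R N -> V (f 0) ->
    (forall m, eps < m -> ~ q m (f 0)) -> V1 (f 0).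
  move=> Ff fN Vf nq; apply: hT => //; rewrite ltNge; apply/negP => ed.
  apply: (nq _ _ (q_dist Vf)); apply: lt_le_trans ed; rewrite /eps; lra.
pose B := [set x | [/\ V x, p M x & forall m, eps < m -> ~ q m x]].
have BV1 : B `<=` V1.
  move=> x [Vx pMx nq]; have [f [t [Ff fx t0 Mt fN]]] := p_stays M0 pMx.
  rewrite -fx; apply: good_V1 => //; rewrite ?fx// => r /andP[r0 rT].
  by apply: fN; rewrite r0 (le_trans rT)//; move: Mt; rewrite /M; lra.
have BN : B `<=` N by exact: subset_trans (subset_trans BV1 V1_V) V_N.
(* Both conditions are open: the one on [p] by (K5), the one on [q] by (K4) and admissibility. *)
have BI x : V x -> (exists2 m, M < m & p m x) -> ~ q eps x -> B° x.
  move=> Vx [m Mm pm] nq; near=> y; split.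
  - by near: y; exact: open_nbhs_nbhs.
  - by near: y; apply: (p_nbhs _ Mm pm); exact: lt_trans Mm.
  - have nqy : ~ q eps y by near: y; exact: q_closed.
    by move=> m' em' /(q_le (ltW em')).
have nq_closed x (u : nat -> X) : (forall n, B (u n)) -> u @ \oo --> x ->
    forall m, eps < m -> ~ q m x.
  (* The neighborhood lemmas lose an arbitrarily small amount; the midpoint still exceeds [eps]. *)
  move=> Bu ux m em qm; have em' : eps < (eps + m) / 2 by lra.
  have mm' : (eps + m) / 2 < m by lra.
  have /ux[n _ /(_ n (leqnn n))/=] := q_nbhs (lt_trans eps0 em) mm' qm.
  by have [_ _] := Bu n; apply.
have Bcl : closed B.
  move=> x /closure_seq[u Bu ux].
  have nqx := nq_closed x u Bu ux.
  (* [V] is only open; the limit remains in it because [B] lies in [V1], whose closure is inside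
     [V]. *)
  have Vx : V x.
    by apply: V1V; apply: closed_cvg (@closed_closure _ V1) _ _ ux;
       apply: nearW => n; apply: subset_closure; exact: BV1.
  split => //.
  have /choice[P hP] : forall n, exists P : (R -> X) * R,
      [/\ real_paths F P.1, P.1 0 = u n, 0 <= P.2 &
      forall r, 0 <= r <= P.2 -> M <= (1 + P.2) * 1 * Q (P.1 r)].
    by move=> n; have [_ [t t0 [f [Ff f0 fM]]] _] := Bu n; exists (f, t).
  (* If the times (P k).2 have a bounded subsequence, (K4) yields a limit
     attaining M; otherwise the limit trajectory f stays in N, hence in V,
     forever. *)
  have [[C hC]|noC] :=
      pselect (exists C, forall n, exists2 k, (n <= k)%N & (P k).2 <= C).
    have /choice[k hk] : forall n, exists k, (n <= k)%N /\ (P k).2 <= C.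
      by move=> n; have [k ? ?] := hC n; exists k.
    have [_ _ ac] := @growing_weight R.
    apply: (attains_limit Fc Qc h1c (C := C)
      (g_ := fun n => (P (k n)).1) (t_ := fun n => (P (k n)).2) F4 ac).
    - by move=> n; have [] := hP (k n).
    - by move=> n; have [_ _ -> _] := hP (k n); rewrite (hk n).2.
    - by move=> n; have [] := hP (k n).
    - have -> : (fun n => (P (k n)).1 0) = u \o k.
        by apply/funext => n; have [] := hP (k n).
      by apply: cvg_comp ux; apply: cvg_ge_id => n; exact: (hk n).1.
  have /choice[k hk] : forall n, exists k, (n <= k)%N /\ n%:R <= (P k).2.
    move=> n; apply: contrapT => nk; apply: noC; exists n%:R => j.
    exists (maxn n j); first exact: leq_maxr.
    rewrite leNgt; apply/negP => nP; apply: nk; exists (maxn n j).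
    by rewrite leq_maxl ltW.
  have kx : (P (k n)).1 0 @[n --> \oo] --> x.
    have -> : (fun n => (P (k n)).1 0) = u \o k.
      by apply/funext => n; have [] := hP (k n).
    by apply: cvg_comp ux; apply: cvg_ge_id => n; exact: (hk n).1.
  have [|f [Ff fx] fN] := stays_forever_limit Fc F4 adm
    (g_ := fun n => (P (k n)).1) _ kx.
    move=> n; have [FP _ P0 PM] := hP (k n); split => // s /andP[s0 sn].
    have /PM : 0 <= s <= (P (k n)).2.
      by rewrite s0 (le_trans sn)//; exact: (hk n).2.
    move=> h; apply: gN; apply: Q_gt0; move: h.
    have /andP[+ _] := Q01 ((P (k n)).1 s); rewrite le_eqVlt => /predU1P[<-|//].
    by rewrite mulr0 leNgt M0.
  rewrite -fx; apply: p_forever => //; first exact: ltW.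
  (* While [f] is in [V], no value of [q] above [eps] occurs along it, or one would occur at [x]. As
     [f] stays in [N] forever, [good_V1] puts it in [V1], so it never leaves [V]. *)
  have := real_paths_continuous Fc Ff.
  move=> /(@open_closed_forward _ _ f V (closure V1)); apply => //.
  - exact: closed_closure.
  - by rewrite fx.
  move=> r r0 fV; apply: subset_closure.
  have Ffr : real_paths F (fun s => f (r + s)) by exact: real_paths_translate.
  have := good_V1 _ Ffr; rewrite addr0; apply.
  - by move=> s /andP[s0 _]; apply: fN; rewrite addr_ge0.
  - by apply: fV; rewrite r0 lexx.
  - move=> m em; move: r0; rewrite le_eqVlt => /predU1P[<-|r0] qm.
      by apply: (nqx m em); rewrite -fx.
    have [m' mm' qm'] := q_before (lt_trans eps0 em) r0 Ff fV qm.
    by apply: (nqx m' (lt_trans em mm')); rewrite -fx.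
have KB : K `<=` B°.
  move=> x Kx; have [f [Ff fx] fK] := invariant_set_forward KN Kx.
  apply: BI; first exact/V1_V/K_V1.
  - exists (M + 1); first by rewrite ltrDl.
    rewrite -fx; apply: p_forever => //; first by rewrite addr_ge0// ltW.
    by move=> r _; exact/V1_V/K_V1.
  (* Points reached from [K] within [N] are asymptotic, so [dist] vanishes there. *)
  - move=> /(q_stays eps0)[h [t [Fh hx t0 + hN]]]; rewrite /dist set_dist0.
      by rewrite mulr0 leNgt eps0.
    by apply: (invariant_set_asymptotic F3 KN) => //; rewrite hx.
exists B => //.
have boundB x : boundary B x -> B x.
  by move=> [+ _]; rewrite -((closure_id B).1 Bcl).
have exit_after x delta sigma : B x -> (forall m, M < m -> ~ p m x) ->
    trajectory_through F x delta sigma -> right_after sigma (~` B).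
  move=> [Vx pMx nqx] np tr.
  have [d d0 dV] := trajectory_near tr (open_nbhs_nbhs (conj Vopen Vx)).
  have [delta0 _ sx] := tr.
  exists d => // t /andP[t0 td] [_ pt _].
  have [||m' Mm' pm'] := p_trajectory tr M0 _ t0 _ pt.
  - by rewrite oppr_le0.
  - by move=> r /andP[r0 rt]; apply: dV; lra.
  - by apply: (np m' Mm'); rewrite -sx.
(* Just before time 0, [q] exceeds [eps]; this serves bounce-off and ingress points alike. *)
have exit_before x delta sigma : B x -> q eps x ->
    trajectory_through F x delta sigma -> right_before delta sigma (~` B).
  move=> [Vx pMx nqx] qx tr delta0.
  have [d d0 dV] := trajectory_near tr (open_nbhs_nbhs (conj Vopen Vx)).
  have [_ _ sx] := tr.
  (* [right_before] asks for a length strictly below [delta]. *)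
  exists (Num.min d (delta / 2)).
    by rewrite lt_min d0 gt_min; apply/andP; split; [|apply/orP; right]; lra.
  move=> t /andP[+ t0] [_ _ nqt]; rewrite lerNl le_min => /andP[td tdelta].
  have [|||m' em' qm'] := @q_trajectory x delta sigma tr eps t 0 eps0 _ t0.
  - lra.
  - by move=> r /andP[tr0 r0]; apply: dV; lra.
  - by rewrite sx.
  - exact: (nqt m' em').
(* Going back in time [p] only grows, and [~ q eps] persists near [x]. *)
have egress_before x delta sigma : B x -> ~ q eps x ->
    trajectory_through F x delta sigma -> right_before delta sigma B.
  move=> [Vx pMx nqx] nq tr delta0.
  have [d d0 dV] := trajectory_near tr (open_nbhs_nbhs (conj Vopen Vx)).
  have [d' d'0 dq] := trajectory_near tr (q_closed eps0 nq).
  have [_ _ sx] := tr.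
  exists (Num.min (Num.min d d') (delta / 2)).
    rewrite !lt_min d0 d'0 gt_min.
    by apply/andP; split; [|apply/orP; right]; lra.
  move=> t /andP[+ t0]; rewrite lerNl !le_min => /andP[/andP[td td'] tdelta].
  have dt : - delta <= t by lra.
  split; first by apply: dV => //; lra.
  - have [||m' Mm' pm'] := @p_trajectory x delta sigma tr M t 0 M0 dt t0.
    + by move=> r /andP[tr0 r0]; apply: dV; lra.
    + by rewrite sx.
    + exact: p_le (ltW Mm') pm'.
  - have nqt : ~ q eps (sigma t) by apply: dq => //; lra.
    by move=> m em /(q_le (ltW em)).
have ingress_after x delta sigma : B x -> (exists2 m, M < m & p m x) ->
    trajectory_through F x delta sigma -> right_after sigma B°.
  move=> [Vx pMx nqx] [m Mm pm] tr.
  have [d d0 dV] := trajectory_near tr (open_nbhs_nbhs (conj Vopen Vx)).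
  have Mm' : M < (M + m) / 2 by lra.
  have mm' : (M + m) / 2 < m by lra.
  have [d' d'0 dp] := trajectory_near tr (p_nbhs (lt_trans M0 Mm) mm' pm).
  have [delta0 _ sx] := tr.
  exists (Num.min d d'); first by rewrite lt_min d0 d'0.
  move=> t /andP[t0]; rewrite le_min => /andP[td td'].
  apply: BI; first by apply: dV; lra.
  - by exists ((M + m) / 2) => //; apply: dp; lra.
  - move=> qt; have [||m' em' qm'] := q_trajectory tr eps0 _ t0 _ qt.
    + by rewrite oppr_le0.
    + by move=> r /andP[r0 rt]; apply: dV; lra.
    + by apply: (nqx m' em'); rewrite -sx.
have exitP x : boundary B x -> (forall m, M < m -> ~ p m x) -> exit_set F B x.
  move=> bx np; have Bx := boundB x bx.
  have [qx|nqx] := pselect (q eps x); [right|left]; split => // delta sigma tr.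
  - by split; [exact: exit_after tr|exact: exit_before tr].
  - by split; [exact: exit_after tr|exact: egress_before tr].
have ingressP x : boundary B x -> (exists2 m, M < m & p m x) -> ingress F B x.
  move=> bx pm; have Bx := boundB x bx.
  (* Otherwise [BI] would make [x] an interior point. *)
  have qx : q eps x.
    by apply: contrapT => nq; case: bx => _; apply; apply: BI => //; case: Bx.
  split => // delta sigma tr.
  by split; [exact: ingress_after tr|exact: exit_before tr].
(* In this form the exit set is closed, since attaining some [m] above [M] is an open condition. *)
have exitE : exit_set F B = [set x | B x /\ forall m, M < m -> ~ p m x].
  apply/seteqP; split => x /=.
  - move=> ex; have bx : boundary B x by case: ex => -[].
    split; first exact: boundB.
    move=> m Mm pm; apply: (exit_ingress_disjoint F1 ex); apply: ingressP => //.
    by exists m.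
  - move=> [Bx np]; apply: exitP => //; split; first exact: subset_closure.
    (* The trajectory from (K1) leaves [B] right after time 0, which is impossible from an interior
       point. *)
    move=> Bix; have [phi Fphi phix] := F1 x.
    have tr := trajectory_from_start Fphi; rewrite phix in tr.
    have [d d0 dB] := trajectory_near tr Bix.
    have [d' d'0 dnB] := exit_after _ _ _ Bx np tr.
    have m0 : 0 < Num.min d d' by rewrite lt_min d0 d'0.
    apply: (dnB (Num.min d d')); first by rewrite m0 ge_min lexx orbT.
    by apply: dB; [lra|rewrite ge_min lexx/=; lra].
split => //.
- have [_ _ [Kinv _ Kmax]] := KN; split => //; split => // [|A' A'inv A'B].
    exact: subset_trans KB (@interior_subset _ _).
  by apply: Kmax => //; exact: subset_trans BN.
- apply/seteqP; split => x; last by move=> [[[]|[]]|[]].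
  move=> bx; have [pm|np] := pselect (exists2 m, M < m & p m x).
    by right; exact: ingressP.
  by left; apply: exitP => // m Mm pm; apply: np; exists m.
- rewrite exitE => x /closure_seq[u hu ux]; split.
    apply: closed_cvg Bcl _ _ ux; apply: nearW => n; exact: (hu n).1.
  move=> m Mm pm; have Mm' : M < (M + m) / 2 by lra.
  have mm' : (M + m) / 2 < m by lra.
  have /ux[n _ /(_ n (leqnn n))/=] := p_nbhs (lt_trans M0 Mm) mm' pm.
  exact: (hu n).2.
Unshelve. all: by end_near. Qed.

End block.

Theorem theorem3p10 (R : realType) (X : metricType R)
  (F Ft : set (halfline R -> X)) (K Kt N : set X)
  (FFt : F `<=` Ft) (Ftcont : Ft `<=` cont_halfline)
  (F1 : K1 F) (F2 : K2 F) (F3 : K3 F) (F4 : K4 F)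
  (Ft1 : K1 Ft) (Ft2 : K2 Ft) (Ft3 : K3 Ft) (Ft4 : K4 Ft)
  (Kisolated : isolated_weakly_invariant F K)
  (Nadm : admissible F N)
  (Nisolating : isolating_neighborhood F K N)
  (Ktisolated : isolated_weakly_invariant Ft Kt)
  (KKt : K `<=` Kt)
  (Ntadm : admissible Ft N)
  (Ntisolating : isolating_neighborhood Ft Kt N)
  (Ft5 : K5 Ft Kt) :
  exists B : set X, isolating_block F K B.
Proof.
have [Kt0|/set0P Kt0] := eqVneq Kt set0.
  have -> : K = set0 by rewrite -subset0 -Kt0.
  by exists set0; exact: isolating_block_set0.
have [Ktcl _ _] := Ktisolated; have [_ _ Kmax] := Nisolating.
have [_ KtN _] := Ntisolating.
have [W [oW KtW lsc]] := real_paths_lsc Ftcont Ft5.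
(* The cut-off is to be positive only inside [N], where admissibility acts, and inside [W], where
   (K5) gives nearby trajectories. *)
have [||g [gc gK gNW]] := @urysohn_open_nbhs _ _ Kt (N° `&` W) Ktcl.
- by apply: openI => //; exact: open_interior.
- by move=> x Ktx; split; [exact: KtN|exact: KtW].
have [|| B BN Bblock] := isolating_block_of_plateau Ftcont Ft1 Ft2 Ft3 Ft4 Ntadm
  Ntisolating lsc gc gK _ _ Kt0.
- by move=> x /gNW[/interior_subset].
- by move=> x /gNW[].
by exists B; exact: (isolating_block_sub FFt F1 KKt Kmax BN Bblock).
Qed.
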